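(* Let $S$ be a Clifford subsemigroup of $\mathbb{N}^{\mathbb{N}}$. Then $S$ endowed with the subspace topology is a topological inverse semigroup.
   Context: $\mathbb{N}^{\mathbb{N}}$ is the monoid of all functions $\mathbb{N}\to\mathbb{N}$ under composition (functions act on the right and compose from left to right), with the product topology arising from the discrete topology on $\mathbb{N}$. An inverse semigroup is a semigroup $S$ such that for each $x\in S$ there is a unique $x^{-1}\in S$ with $xx^{-1}x=x$ and $x^{-1}xx^{-1}=x^{-1}$. It is Clifford if $xx^{-1}=x^{-1}x$ for all $x\in S$. A Clifford subsemigroup of $\mathbb{N}^{\mathbb{N}}$ is a subsemigroup which is itself a Clifford semigroup. A topological inverse semigroup is an inverse semigroup with a topology for which both multiplication and inversion $x\mapsto x^{-1}$ are continuous. *)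

(* Defs.v *)
From HB Require Import structures.
From mathcomp Require Import all_boot.
From mathcomp Require Import all_classical all_analysis.

Set Implicit Arguments.
Unset Strict Implicit.
Unset Printing Implicit Defensive.

Local Open Scope classical_set_scope.
Local Open Scope group_scope.

Definition is_sginv (T : semigroupType) (x y : T) : Prop :=
  x * y * x = x /\ y * x * y = y.

Definition inverse_semigroup (T : semigroupType) : Prop :=
  forall x : T, exists! y : T, is_sginv x y.

(* Junk value x when x has no semigroup inverse; this is independent of the
   choice made by xget when T is an inverse semigroup. *)
Definition sginv (T : semigroupType) (x : T) : T := xget x (is_sginv x).

Definition clifford_semigroup (T : semigroupType) : Prop :=
  inverse_semigroup T /\ forall x : T, x * sginv x = sginv x * x.

(* A semigroup that carries a topology, with no compatibility required. *)
#[short(type="semigroupTopologyType")]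
HB.structure Definition SemigroupTopology :=
  {T of Semigroup T & Topological T}.

Definition topological_inverse_semigroup (T : semigroupTopologyType) : Prop :=
  [/\ inverse_semigroup T,
      continuous (fun xy : T * T => xy.1 * xy.2) &
      continuous (@sginv T)].

Definition subsemigroup (T : semigroupType) (S : set T) : Prop :=
  forall x y : T, S x -> S y -> S (x * y).

Definition subsg (T : semigroupType) (S : set T) (hS : subsemigroup S) : Type :=
  set_type S.

Section SubSemigroup.
Context (T : semigroupType) (S : set T) (hS : subsemigroup S).

Definition subsg_mul (x y : subsg hS) : subsg hS :=
  exist _ (val x * val y) (mem_set (hS (set_valP x) (set_valP y))).

HB.instance Definition _ := Choice.copy (subsg hS) (set_type S).

Lemma subsg_mulA : associative subsg_mul.
Proof. by move=> x y z; apply: val_inj; rewrite /= monoid.mulgA. Qed.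

HB.instance Definition _ := isSemigroup.Build (subsg hS) subsg_mulA.

End SubSemigroup.

HB.instance Definition _ (T : semigroupTopologyType) (S : set T)
  (hS : subsemigroup S) := Topological.copy (subsg hS) (set_type S).

Definition NN : Type := {ptws nat -> nat}.

HB.instance Definition _ := Topological.on NN.

(* Functions act on the right: f * g is f followed by g. *)
Definition NN_mul (f g : NN) : NN := fun n => g (f n).
Definition NN_one : NN := fun n => n.

Lemma NN_mulA : associative NN_mul. Proof. by []. Qed.
Lemma NN_1mul : left_id NN_one NN_mul. Proof. by []. Qed.
Lemma NN_mul1 : right_id NN_one NN_mul. Proof. by []. Qed.

HB.instance Definition _ := isMonoid.Build NN NN_mulA NN_1mul NN_mul1.

(* Main.v *)
Require Import Defs.
From mathcomp Require Import all_boot all_classical all_analysis.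

(** In the topology of pointwise convergence, x and y are close when they agree
at prescribed finitely many points. Multiplication is continuous because the
value of fg at n is determined by the values of f at n and of g at n f.

For inversion, functions being written on the right, put m = n x^-1. The claim
is that n y^-1 = m as soon as n y = n x and m y = m x: two values of y already
determine the value of y^-1 at n. In an inverse semigroup idempotents commute,
and in a Clifford semigroup they are even central. For y as in the claim,
- n y^-1 is fixed by x x^-1: one has y^-1 = y y^-1 y^-1, and the central
  idempotent x x^-1 can be moved to just after the first y, where n y = n x
  absorbs it;
- m is fixed by y y^-1: one has m = m x x^-1, and the central idempotent
  y y^-1 can be moved to just after x, where m x = m y absorbs it.
Hence n y^-1 = n y^-1 x x^-1 = n x^-1 x y^-1 = m x y^-1 = m y y^-1 = m.

Only the right action of the semigroup on the points enters this computation,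
so it is carried out in act_sginv_eq for an arbitrary Clifford semigroup acting
on a type; the rest is the centrality of idempotents, clifford_idem_central. *)

Set Implicit Arguments.
Unset Strict Implicit.
Unset Printing Implicit Defensive.

Local Open Scope classical_set_scope.
Local Open Scope group_scope.

(** * Idempotents of an inverse semigroup *)

Section InverseSemigroup.
Context (T : semigroupType) (invT : inverse_semigroup T).
Implicit Types x y e f : T.

Let mulA := @monoid.mulgA T.

Lemma sginvP x : is_sginv x (sginv x).
Proof. by have [y [xy _]] := invT x; exact: (xgetI _ xy). Qed.

Lemma mulKsg x : x * sginv x * x = x.
Proof. by have [] := sginvP x. Qed.

Lemma sginvKsg x : sginv x * x * sginv x = sginv x.
Proof. by have [] := sginvP x. Qed.

Lemma sginv_uniq x y z : is_sginv x y -> is_sginv x z -> y = z.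
Proof. by have [w [_ u]] := invT x => /u <- /u <-. Qed.

Lemma idem_sginv e : e * e = e -> is_sginv e e.
Proof. by move=> ee; split; rewrite !ee. Qed.

(** If z is the inverse of ef, then fze is also an inverse of ef, so z = fze;
this makes z idempotent. Then z has both z and ef as inverses, so ef = z. *)
Lemma idem_mul e f : e * e = e -> f * f = f -> e * f * (e * f) = e * f.
Proof.
move=> ee ff; set z := sginv (e * f).
have [efz zef] : is_sginv (e * f) z by exact: sginvP.
have fzeV : is_sginv (e * f) (f * z * e).
  split.
  - by rewrite -[RHS]efz !mulA -(mulA e f f) ff -(mulA _ e e) ee.
  - rewrite -[X in _ = f * X * e]zef !mulA.
    by rewrite -(mulA _ e e) ee -(mulA _ f f) ff.
have zE : z = f * z * e by apply: sginv_uniq fzeV; exact: sginvP.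
have zz : z * z = z.
  rewrite {1}zE {2}zE !mulA -(mulA _ e f).
  by rewrite -(mulA (f * z)) -(mulA f) (mulA z) zef -zE.
have ->// : e * f = z.
apply: (@sginv_uniq z); last exact: idem_sginv.
by split.
Qed.

(** Products of idempotents being idempotent, ef has both ef and fe as
inverses. *)
Lemma idemC e f : e * e = e -> f * f = f -> e * f = f * e.
Proof.
move=> ee ff; apply: (@sginv_uniq (e * f)).
  exact/idem_sginv/idem_mul.
split.
- by rewrite !mulA -(mulA e f f) ff -(mulA _ e e) ee -mulA idem_mul.
- by rewrite !mulA -(mulA f e e) ee -(mulA _ f f) ff -mulA idem_mul.
Qed.

Lemma idem_mulsgV x : x * sginv x * (x * sginv x) = x * sginv x.
Proof. by rewrite mulA mulKsg. Qed.

End InverseSemigroup.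

(** * Clifford semigroups and their actions *)

Section Clifford.
Context (T : semigroupType) (cT : clifford_semigroup T).
Implicit Types x y e : T.

Let mulA := @monoid.mulgA T.
Let invT : inverse_semigroup T := cT.1.

(** Let x' be the inverse of x and i = xx' = x'x. The inverse of ex is x'e, so
the Clifford identity for ex reads ei = x'ex. Multiplying it by x on the left
gives xei = iex, and both sides simplify, to xe and ex respectively, because i
commutes with e and is neutral for x. *)
Lemma clifford_idem_central e x : e * e = e -> e * x = x * e.
Proof.
move=> ee; set x' := sginv x; set i := x * x'.
have iE : x' * x = i by rewrite -cT.2.
have ei : e * i = i * e by apply: idemC => //; exact: idem_mulsgV.
have ix : i * x = x by exact: mulKsg.
have xi : x * i = x by rewrite -iE mulA.
have x'i : x' * i = x' by rewrite mulA sginvKsg.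
have eie : e * i * e = e * i by rewrite {1}ei -mulA ee.
have exV : is_sginv (e * x) (x' * e).
  have exx'e : e * x * (x' * e) = e * i by rewrite -eie !mulA.
  split.
  - by rewrite exx'e {1}ei -(mulA i) (mulA e e) ee mulA -ei -mulA ix.
  - by rewrite -mulA exx'e -mulA (mulA e e) ee ei mulA x'i.
have sE : sginv (e * x) = x' * e.
  by apply: sginv_uniq exV => //; exact: sginvP.
have ei_conj : e * i = x' * e * x.
  have := cT.2 (e * x); rewrite sE.
  rewrite -(mulA e x) (mulA x x') (mulA e) eie => ->.
  by rewrite mulA -(mulA x' e e) ee.
rewrite -[in RHS]xi -(mulA x) -ei ei_conj !mulA -/i -ei.
by rewrite -mulA ix.
Qed.

Lemma mulsgV_central x y : x * sginv x * y = y * (x * sginv x).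
Proof. by apply: clifford_idem_central; exact: idem_mulsgV. Qed.

(** For functions acting on points, the two hypotheses on y define a
neighbourhood of x for pointwise convergence: this is what makes inversion
continuous. *)
Lemma act_sginv_eq (A : Type) (act : A -> T -> A)
    (actM : forall a x y, act a (x * y) = act (act a x) y)
    (x y : T) (a : A) (b := act a (sginv x)) :
  act a y = act a x -> act b y = act b x -> act a (sginv y) = b.
Proof.
move=> ya yb; set x' := sginv x; set y' := sginv y.
have xE : x * (x * x') = x by rewrite -mulsgV_central mulKsg.
have yE : y * (y * y') = y by rewrite -mulsgV_central mulKsg.
have x'E : x' * (x * x') = x' by rewrite mulA sginvKsg.
have y'E : y * y' * y' = y' by rewrite mulsgV_central mulA sginvKsg.
have ay'_fix : act a (y' * (x * x')) = act a y'.
  have -> : y' * (x * x') = y * (x * x') * (y' * y').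
    by rewrite -{1}y'E -[in RHS]mulsgV_central -mulsgV_central !mulA.
  by rewrite actM (actM a y) ya -(actM a) xE -ya -actM mulA y'E.
have b_fix : act b (y * y') = b.
  have bE : b = act (act b x) x' by rewrite -actM -actM x'E.
  rewrite {1}bE -actM -mulsgV_central actM -{1}yb -(actM b y) yE yb.
  exact: esym bE.
rewrite -ay'_fix -mulsgV_central (cT.2 x) -mulA !actM -/b -yb -actM.
exact: b_fix.
Qed.

End Clifford.

(** * The topology of pointwise convergence *)

Section Topology.
Context (S : set NN) (hS : subsemigroup S).

Lemma near_subsg_app (x : subsg hS) (n : nat) :
  \forall y \near x, val y n = val x n.
Proof.
have val_cts : continuous (val : subsg hS -> NN) by exact: initial_continuous.
have eval_cts : continuous (fun f : NN => f n).
  exact: (@proj_continuous _ (fun=> nat)).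
have : {for x, continuous (fun y : subsg hS => (val y : NN) n)}.
  exact: continuous_comp (val_cts x) (eval_cts _).
by move=> /(_ _ (discrete_set1 _)).
Qed.

(** The discrete topology on the values turns convergence at each point into
eventual equality. *)
Lemma continuous_subsg (X : topologicalType) (h : X -> subsg hS) :
  (forall x n, \forall y \near x, val (h y) n = val (h x) n) -> continuous h.
Proof.
move=> H; apply: continuous_comp_initial => x.
apply/pointwise_cvgP => n; apply/discrete_cvg; exact: H.
Qed.

End Topology.

Theorem proposition3p17 (S : set NN) (hS : subsemigroup S) :
  clifford_semigroup (subsg hS) -> topological_inverse_semigroup (subsg hS).
Proof.
move=> cS; have invS := cS.1; split => //.
- apply: continuous_subsg => -[f g] n.
  have nearf : \forall fg \near (f, g), val fg.1 n = val f n.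
    exact: cvg_fst (near_subsg_app f n).
  have nearg : \forall fg \near (f, g), val fg.2 (val f n) = val g (val f n).
    exact: cvg_snd (near_subsg_app g (val f n)).
  near=> fg.
  have fn : val fg.1 n = val f n by near: fg.
  have gfn : val fg.2 (val f n) = val g (val f n) by near: fg.
  exact: etrans (congr1 (val fg.2) fn) gfn.
- apply: continuous_subsg => x n.
  near=> y.
  apply: (act_sginv_eq cS (act := fun k z => val z k)) => //.
  + by near: y; exact: near_subsg_app.
  + by near: y; exact: near_subsg_app.
Unshelve. all: by end_near.
Qed.
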